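(* Let $p$ be a prime, let $A_p=\mathbb{C}[\mathbb{Z}/p]$ be the group Hopf algebra with its standard basis of group elements $|0\rangle,|1\rangle,\ldots,|p-1\rangle$, let $\omega\in\mathbb{C}$ be a nontrivial $p$-th root of unity, and for $0\le j\le p-1$ let $$F_j=\frac1p\sum_{i=0}^{p-1}\omega^{ij}\,|i\rangle\in A_p .$$ Then, in the basis $\{F_j\}_{j=0}^{p-1}$ of $A_p$, the coalgebra structure maps of $A_p$ are given by $$\Delta(F_j)=\sum_{\substack{0\le I,J\le p-1\\ I+J\equiv j \bmod p}}F_I\otimes F_J,\qquad \epsilon(F_j)=\delta_{0j}$$ for all $0\le j\le p-1$.
   Context: $|i\rangle$ denotes the element $i\in\mathbb{Z}/p$ regarded as an element of the group algebra $\mathbb{C}[\mathbb{Z}/p]$ (so $|0\rangle$ is the multiplicative identity). The coalgebra structure of the group algebra is the standard one: $\Delta(|i\rangle)=|i\rangle\otimes|i\rangle$ and $\epsilon(|i\rangle)=1$. $\delta_{0j}$ is the Kronecker delta. *)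

(* Defs.v *)
From HB Require Import structures.
From mathcomp Require Import all_boot all_order all_algebra.

Set Implicit Arguments.
Unset Strict Implicit.
Unset Printing Implicit Defensive.

Import GRing.Theory.
Local Open Scope ring_scope.

(* Needed for G * H to be recognised as a finZmodType. *)
HB.saturate prod.

(* The group algebra K[G] of a finite abelian group G written additively; an
   element is given by its coordinates on the basis G.  The type is a copy of
   {ffun G -> K^o} because the latter carries the pointwise product. *)
Definition galg (K : fieldType) (G : finZmodType) : Type := {ffun G -> K^o}.

HB.instance Definition _ K G := Vector.copy (galg K G) {ffun G -> K^o}.

Section GroupAlgebra.
Variables (K : fieldType) (G : finZmodType).
Implicit Types (u v w : galg K G) (g h : G).

Definition coef u g : K := (u : {ffun G -> K^o}) g.

Definition ofcoef (f : G -> K) : galg K G := [ffun g => f g : K^o].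

Definition ket g : galg K G := ofcoef (fun h => (h == g)%:R).

Definition galg_mul u v : galg K G :=
  ofcoef (fun g => \sum_h coef u h * coef v (g - h)).

Lemma coefE f g : coef (ofcoef f) g = f g.
Proof. by rewrite /coef ffunE. Qed.

Lemma coefP u v : (forall g, coef u g = coef v g) -> u = v.
Proof. by move=> e; apply/ffunP. Qed.

Lemma coefD u v g : coef (u + v) g = coef u g + coef v g.
Proof. by rewrite /coef ffunE. Qed.

Lemma coefZ a u g : coef (a *: u) g = a * coef u g.
Proof. by rewrite /coef ffunE. Qed.

Lemma coef0 g : coef 0 g = 0.
Proof. by rewrite /coef ffunE. Qed.

Lemma coef_sum I r (P : pred I) (F : I -> galg K G) g :
  coef (\sum_(i <- r | P i) F i) g = \sum_(i <- r | P i) coef (F i) g.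
Proof. by elim/big_rec2: _ => [|i x y _ <-]; rewrite ?coef0 ?coefD. Qed.

Lemma galg_ketE u : u = \sum_g coef u g *: ket g.
Proof.
apply: coefP => h; rewrite coef_sum (bigD1 h) //= coefZ coefE eqxx mulr1.
rewrite big1 ?addr0 // => g gh.
by rewrite coefZ coefE eq_sym (negPf gh) mulr0.
Qed.

Lemma galg_mulC : commutative galg_mul.
Proof.
move=> u v; apply: coefP => g; rewrite !coefE.
rewrite (reindex_inj (inv_inj (fun h => subKr g h))) /=.
by apply: eq_bigr => h _; rewrite mulrC subKr.
Qed.

Lemma galg_mulA : associative galg_mul.
Proof.
move=> u v w; apply: coefP => g; rewrite !coefE.
under eq_bigr => h _ do rewrite coefE mulr_sumr.
under [RHS]eq_bigr => h _ do rewrite coefE mulr_suml.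
rewrite [RHS]exchange_big /=; apply: eq_bigr => h _.
rewrite [RHS](reindex_inj (addrI h)) /=; apply: eq_bigr => k _.
by rewrite mulrA opprD addrA [h + k]addrC addrK.
Qed.

Lemma galg_mul1 : left_id (ket 0) galg_mul.
Proof.
move=> u; apply: coefP => g; rewrite coefE (bigD1 0) //= coefE eqxx mul1r subr0.
by rewrite big1 ?addr0 // => h h0; rewrite coefE (negPf h0) mul0r.
Qed.

Lemma galg_mulDl : left_distributive galg_mul +%R.
Proof.
move=> u v w; apply: coefP => g; rewrite coefD !coefE -big_split /=.
by apply: eq_bigr => h _; rewrite coefD mulrDl.
Qed.

Lemma galg_one_neq0 : ket 0 != 0.
Proof.
apply/eqP => /(congr1 (coef^~ 0)); rewrite coefE coef0 eqxx => /eqP.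
by rewrite oner_eq0.
Qed.

HB.instance Definition _ := GRing.Zmodule_isComNzRing.Build (galg K G)
  galg_mulA galg_mulC galg_mul1 galg_mulDl galg_one_neq0.

Lemma galg_scaleAl (a : K) u v : a *: (u * v) = (a *: u) * v.
Proof.
apply: coefP => g; rewrite coefZ !coefE mulr_sumr.
by apply: eq_bigr => h _; rewrite coefZ mulrA.
Qed.

HB.instance Definition _ :=
  GRing.Lmodule_isLalgebra.Build K (galg K G) galg_scaleAl.
HB.instance Definition _ := GRing.Lalgebra_isComAlgebra.Build K (galg K G).

Lemma ket0 : ket 0 = 1. Proof. by []. Qed.

Lemma ketD g h : ket (g + h) = ket g * ket h.
Proof.
apply: coefP => k; rewrite !coefE (bigD1 g) //= !coefE eqxx mul1r.
rewrite big1 ?addr0 => [|l lg]; last by rewrite coefE (negPf lg) mul0r.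
by rewrite subr_eq [h + g]addrC.
Qed.

End GroupAlgebra.

(* K[G] (x) K[H], realised as K[G x H] with |g> (x) |h> = |(g, h)>;
   tens_bilinear and tens_universal show that it is the tensor product. *)
Definition tens (K : fieldType) (G H : finZmodType)
    (u : galg K G) (v : galg K H) : galg K (G * H)%type :=
  ofcoef (fun x => coef u x.1 * coef v x.2).

Notation "u ⊗ v" := (tens u v) (at level 40, left associativity) : ring_scope.

Section Tensor.
Variables (K : fieldType) (G H : finZmodType).

Lemma tens_bilinear : bilinear_for *:%R *:%R (@tens K G H).
Proof.
split=> w a u v; apply: coefP => x; rewrite !(coefD, coefZ, coefE).
  by rewrite mulrDl mulrA.
by rewrite mulrDr mulrCA.
Qed.

Lemma tens_ket g h : ket K g ⊗ ket K h = ket K ((g, h) : (G * H)%type).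
Proof. by apply: coefP => -[x y]; rewrite !coefE -natrM mulnb. Qed.

Lemma tens_universal (W : lmodType K) (f : galg K G -> galg K H -> W) :
  bilinear_for *:%R *:%R f ->
  exists2 F : {linear galg K (G * H)%type -> W},
    forall u v, F (u ⊗ v) = f u v
  & forall F' : {linear galg K (G * H)%type -> W},
      (forall u v, F' (u ⊗ v) = f u v) -> F' =1 F.
Proof.
case=> fl fr.
pose f1 v := GRing.isLinear.Build K (galg K G) W *:%R (fun u => f u v) (fl v).
pose F1 v : {linear galg K G -> W} := HB.pack (fun u => f u v) (f1 v).
pose f2 u := GRing.isLinear.Build K (galg K H) W *:%R (f u) (fr u).
pose F2 u : {linear galg K H -> W} := HB.pack (f u) (f2 u).
pose F0 (x : galg K (G * H)%type) :=
  \sum_(y : G * H) coef x y *: f (ket K y.1) (ket K y.2).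
have F0lin : linear F0.
  move=> a x y; rewrite /F0 scaler_sumr -big_split /=; apply: eq_bigr => z _.
  by rewrite coefD coefZ scalerDl scalerA.
pose F0M := GRing.isLinear.Build K (galg K (G * H)%type) W *:%R F0 F0lin.
pose F : {linear galg K (G * H)%type -> W} := HB.pack F0 F0M.
have FE x : F x = F0 x by [].
exists F => [u v | F' F'E x].
  rewrite FE /F0.
  under eq_bigr => y _ do rewrite coefE -scalerA.
  rewrite -(pair_bigA _ (fun g h =>
    coef u g *: (coef v h *: f (ket K g) (ket K h)))) /=.
  rewrite [in RHS](galg_ketE u).
  rewrite (_ : f _ v = F1 v (\sum_g coef u g *: ket K g)) //.
  rewrite linear_sum; apply: eq_bigr => g _.
  rewrite linearZ -scaler_sumr; congr (_ *: _).
  rewrite [in RHS](galg_ketE v) /=.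
  rewrite (_ : f _ _ = F2 (ket K g) (\sum_h coef v h *: ket K h)) //.
  by rewrite linear_sum; apply: eq_bigr => h _; rewrite linearZ.
rewrite FE /F0 {1}(galg_ketE x) linear_sum; apply: eq_bigr => -[g h] _.
by rewrite linearZ /= -F'E tens_ket.
Qed.

End Tensor.

Section Coalgebra.
Variables (K : fieldType) (G : finZmodType).

(* The linear extensions of |g> |-> |g> (x) |g> and of |g> |-> 1, see
   comult_ket and counit_ket. *)
Definition comult (u : galg K G) : galg K (G * G)%type :=
  \sum_g coef u g *: (ket K g ⊗ ket K g).

Definition counit (u : galg K G) : K := \sum_g coef u g.

Lemma comult_is_linear : linear comult.
Proof.
move=> a u v; rewrite /comult scaler_sumr -big_split /=; apply: eq_bigr => g _.
by rewrite coefD coefZ scalerDl scalerA.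
Qed.

HB.instance Definition _ := GRing.isLinear.Build K (galg K G)
  (galg K (G * G)%type) *:%R comult comult_is_linear.

Lemma counit_is_scalar : scalar counit.
Proof.
move=> a u v; rewrite /counit mulr_sumr -big_split /=; apply: eq_bigr => g _.
by rewrite coefD coefZ.
Qed.

HB.instance Definition _ := GRing.isLinear.Build K (galg K G) K *%R
  counit counit_is_scalar.

Lemma comult_ket g : comult (ket K g) = ket K g ⊗ ket K g.
Proof.
rewrite /comult (bigD1 g) //= coefE eqxx scale1r big1 ?addr0 // => h hg.
by rewrite coefE (negPf hg) scale0r.
Qed.

Lemma counit_ket g : counit (ket K g) = 1.
Proof.
rewrite /counit (bigD1 g) //= coefE eqxx big1 ?addr0 // => h hg.
by rewrite coefE (negPf hg).
Qed.

End Coalgebra.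

(* F_j = p^-1 sum_i w^(ij) |i>.  Only meaningful for 1 < p: 'Z_0 and 'Z_1 are
   both Z/2. *)
Definition fourier (K : fieldType) (p : nat) (w : K) (j : nat) : galg K 'Z_p :=
  p%:R^-1 *: \sum_(i < p) w ^+ (i * j) *: ket K (i%:R : 'Z_p).

(* Main.v *)
Require Import Defs.
From mathcomp Require Import all_boot all_order all_algebra.
From mathcomp Require Import reals complex.
(* [coefE], [coefZ], [coef_sum] also name lemmas on polynomials. *)
Import Defs.

Import GRing.Theory.
Local Open Scope ring_scope.

(** The coordinate of [F_j] at [|g>] is [w ^ (g j) / p], so each claim can be
    read off coordinate by coordinate, and each reduces to the orthogonality
    relation [sum_(i < p) z ^ i = p] or [0] according as the [p]-th root of
    unity [z] equals [1] or not ([sum_unity_root]).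

    - Fourier inversion, [|g> = sum_j w ^ (- g j) F_j] ([ket_fourier]), is the
      relation for [z = w ^ h / w ^ g] at the coordinate [h].  Hence the [p]
      vectors [F_j] span the [p]-dimensional space and form a basis.
    - At [(g, h)] the sum of the [F_I ⊗ F_J] over [I + J = j] is [1 / p ^ 2]
      times the sum over [I] of [w ^ (g I + h (j - I))], that is of
      [w ^ (h j) (w ^ g / w ^ h) ^ I]; it vanishes unless [g = h], where it
      equals [w ^ (g j) / p].  These are the coordinates of the image of [F_j]
      under the linear extension of [|g> |-> |g> ⊗ |g>].
    - The counit of [F_j] is [1 / p] times the sum of the [(w ^ j) ^ g].

    The field and the order [p > 1] of the primitive root [w] are arbitrary
    here; in the theorem [w] is primitive because [p] is prime
    ([prime_unity_root_prim]). *)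

Section Fourier.
Variables (K : fieldType) (p : nat) (w : K).
Hypotheses (p_gt1 : (1 < p)%N) (w_prim : p.-primitive_root w).

(** If [z <> 1], the factor [z - 1] of [z ^ n - 1 = 0] can be cancelled. *)
Lemma sum_unity_root n (z : K) :
  z ^+ n = 1 -> \sum_(i < n) z ^+ i = n%:R * (z == 1)%:R.
Proof.
move=> zn; have [->|z1] := eqVneq z 1.
  rewrite mulr1; under eq_bigr do rewrite expr1n.
  by rewrite sumr_const card_ord.
rewrite mulr0; apply/eqP; have /esym/eqP := subrX1 z n.
by rewrite zn subrr mulf_eq0 subr_eq0 (negPf z1).
Qed.

Lemma natr_neq0 : p%:R != 0 :> K.
Proof. exact: prim_root_natf_neq0 w_prim. Qed.

Lemma expw_neq0 i : w ^+ i != 0.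
Proof. by rewrite expf_neq0 // (prim_root_eq0 w_prim) -lt0n ltnW. Qed.

Lemma ltn_Zp (g : 'Z_p) : (g < p)%N.
Proof. by rewrite -[X in (_ < X)%N](Zp_cast p_gt1). Qed.

Lemma expw_Zp_eq (g h : 'Z_p) : (w ^+ g == w ^+ h) = (g == h).
Proof. by rewrite (eq_prim_root_expr w_prim) !modn_small ?ltn_Zp. Qed.

(** The form of orthogonality in which two characters of [Z/p] are compared. *)
Lemma sum_expw_div (g h : 'Z_p) :
  \sum_(i < p) (w ^+ g / w ^+ h) ^+ i = p%:R * (g == h)%:R.
Proof.
rewrite sum_unity_root.
  rewrite -(inj_eq (mulIf (expw_neq0 h))) divfK ?expw_neq0 // mul1r.
  by rewrite expw_Zp_eq.
by rewrite expr_div_n -!exprM ![(_ * p)%N]mulnC !exprM (prim_expr_order w_prim)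
  !expr1n divr1.
Qed.

Lemma coef_fourier j (g : 'Z_p) :
  coef (fourier p w j) g = p%:R^-1 * w ^+ (g * j).
Proof.
rewrite /fourier coefZ coef_sum (bigD1 (Ordinal (ltn_Zp g))) //=.
rewrite coefZ coefE natr_Zp eqxx mulr1 big1 ?addr0 // => i ig.
rewrite coefZ coefE; case: eqP => [gi|]; last by rewrite mulr0.
case/eqP: ig; apply: val_inj => /=.
by rewrite gi val_Zp_nat // modn_small.
Qed.

(** Fourier inversion. It makes the [F_j] span; since there are as many of them
    as the dimension, independence comes for free. *)
Lemma ket_fourier (g : 'Z_p) :
  ket K g = \sum_(j < p) (w ^+ (g * j))^-1 *: fourier p w j.
Proof.
apply: coefP => h; rewrite coefE coef_sum.
transitivity (p%:R^-1 * \sum_(j < p) (w ^+ h / w ^+ g) ^+ j).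
  by rewrite sum_expw_div mulKf // natr_neq0.
rewrite mulr_sumr; apply: eq_bigr => j _.
by rewrite coefZ coef_fourier expr_div_n -!exprM [RHS]mulrC mulrA.
Qed.

Lemma fourier_basis :
  basis_of (fullv : {vspace galg K 'Z_p}) [tuple fourier p w j | j < p].
Proof.
rewrite basisEdim size_tuple; apply/andP; split.
  apply/subvP => u _; rewrite (galg_ketE u); apply: memv_suml => g _.
  apply: memvZ; rewrite ket_fourier; apply: memv_suml => j _.
  by apply/memvZ/memv_span/mapP; exists j; rewrite ?mem_enum.
by rewrite dimvf /dim /= card_ord muln1 Zp_cast.
Qed.

(** For each [I] exactly one [J < p] satisfies [I + J = j] modulo [p]. *)
Lemma sum_expw_complement (h I j : nat) :
  \sum_(J < p | (I + J == j %[mod p])%N) w ^+ (h * J)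
    = w ^+ (h * j) / w ^+ (h * I).
Proof.
have p_gt0 : (0 < p)%N := ltnW p_gt1.
(* [p - I %% p] stands for [- I] without truncation, as [I %% p < p] *)
pose J0 := Ordinal (ltn_pmod (j + (p - I %% p)) p_gt0).
have IJ0 : (I + J0 = j %[mod p])%N.
  rewrite /= modnDmr -modnDml addnCA subnKC ?modnDr //.
  by rewrite ltnW ?ltn_pmod.
rewrite (big_pred1 J0) => [|J]; last first.
  by rewrite -IJ0 eqn_modDl !modn_small // ltn_ord.
apply: (canRL (mulfK (expw_neq0 _))); rewrite mulrC -exprD -mulnDr.
by apply/eqP; rewrite (eq_prim_root_expr w_prim) -modnMmr IJ0 modnMmr.
Qed.

Lemma coef_comult (u : galg K 'Z_p) (g h : 'Z_p) :
  coef (comult u) (g, h) = coef u g * (g == h)%:R.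
Proof.
rewrite /comult coef_sum (bigD1 g) //= coefZ !coefE /= eqxx mul1r eq_sym.
rewrite big1 ?addr0 // => k kg.
by rewrite coefZ !coefE /= eq_sym (negPf kg) mul0r mulr0.
Qed.

Lemma comult_fourier j :
  comult (fourier p w j) =
    \sum_(I < p) \sum_(J < p | (I + J == j %[mod p])%N)
      fourier p w I ⊗ fourier p w J.
Proof.
apply: coefP => -[g h]; rewrite coef_comult coef_fourier coef_sum.
transitivity (p%:R^-1 * (p%:R^-1 *
    (w ^+ (h * j) * \sum_(I < p) (w ^+ g / w ^+ h) ^+ I))).
  rewrite sum_expw_div; have [->|] := eqVneq g h; last by rewrite !mulr0.
  by rewrite !mulr1 [_ * p%:R]mulrC mulKf ?natr_neq0.
rewrite !mulr_sumr; apply: eq_bigr => I _; rewrite coef_sum.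
under eq_bigr do rewrite coefE /= !coef_fourier mulrA.
rewrite -mulr_sumr sum_expw_complement expr_div_n -!exprM.
by rewrite -!mulrA [in RHS](mulrCA (w ^+ (g * I)))
  [in LHS](mulrCA (w ^+ (h * j))).
Qed.

Lemma counit_fourier j : (j < p)%N -> counit (fourier p w j) = (0%N == j)%:R.
Proof.
move=> j_lt; rewrite /counit.
under eq_bigr do rewrite coef_fourier.
rewrite -mulr_sumr -(big_mkord xpredT (fun i => w ^+ (i * j))) Zp_cast //.
rewrite big_mkord; under eq_bigr do rewrite mulnC exprM.
rewrite sum_unity_root; last first.
  by rewrite exprAC (prim_expr_order w_prim) expr1n.
rewrite mulKf ?natr_neq0 // -(expr0 w) (eq_prim_root_expr w_prim).
by rewrite !modn_small ?(ltnW p_gt1) // eq_sym.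
Qed.

End Fourier.

(** The order of [w] divides the prime [p] and is not [1]. *)
Lemma prime_unity_root_prim (K : fieldType) (p : nat) (w : K) :
  prime p -> p.-unity_root w -> w != 1 -> p.-primitive_root w.
Proof.
move=> p_pr /unity_rootP wp w1.
have [m m_prim m_dvd] := prim_order_exists (prime_gt0 p_pr) wp.
have [m1|/eqP <- //] := orP ((primeP p_pr).2 m m_dvd).
by case/eqP: w1; rewrite -(prim_expr_order m_prim) (eqP m1).
Qed.

Theorem proposition1 (R : realType) (p : nat) (w : R[i])
    (hp : prime p) (hw : p.-unity_root w) (hw1 : w != 1) :
  [/\ basis_of (fullv : {vspace galg R[i] 'Z_p})
        [tuple fourier p w j | j < p],
      forall j : 'I_p,
        comult (fourier p w j) =
          \sum_(I < p) \sum_(J < p | (I + J == j %[mod p])%N)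
            fourier p w I ⊗ fourier p w J
    & forall j : 'I_p, counit (fourier p w j) = (0%N == j)%:R].
Proof.
have w_prim := prime_unity_root_prim _ _ _ hp hw hw1.
have p_gt1 := prime_gt1 hp.
split=> [|j|j].
- exact: fourier_basis.
- exact: comult_fourier.
- exact: counit_fourier.
Qed.
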